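(* Let $R$ be one of the chain rings $\mathbb{G}_4=\mathbb{Z}_4[X]/(X^2+X+1)$, $\mathbb{S}_4=\mathbb{F}_4[X]/(X^2)$, $\mathbb{T}_4=\mathbb{F}_4[X;a\mapsto a^2]/(X^2)$. Then there exist projective arcs with parameters $(166,11)$ and $(186,12)$ in $\mathrm{PHG}(2,R)$.
   Context: $\mathbb{F}_4[X;a\mapsto a^2]$ denotes the skew polynomial ring with commutation rule $Xa=a^2X$. For a finite chain ring $R$ of length $2$ with residue field $\mathbb{F}_q$, the projective Hjelmslev plane $\mathrm{PHG}(2,R)$ is the incidence structure whose points are the free rank-$1$ submodules of the right module $R_R^3$, whose lines are the free rank-$2$ submodules of $R_R^3$, with incidence given by inclusion. A projective $(k,n)$-arc is a set of $k$ points meeting every line in at most $n$ points. *)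

(* Defs.v *)
From mathcomp Require Import all_boot all_algebra.
From mathcomp Require Import zmodp.
Set Implicit Arguments. Unset Strict Implicit. Unset Printing Implicit Defensive.
Import GRing.Theory.

(* A finite ring given concretely by its carrier and its addition and
   multiplication (the ring axioms hold for the three concrete instances
   below; the incidence notions only use + and * ). *)
Record FinRingOps := MkFinRingOps {
  rcar :> finType;
  radd : rcar -> rcar -> rcar;
  rmul : rcar -> rcar -> rcar }.

Section Geometry.
Variable R : FinRingOps.
Definition vec := (R * R * R)%type.
Definition vscale (v : vec) (r : R) : vec :=
  (rmul v.1.1 r, rmul v.1.2 r, rmul v.2 r).
Definition vadd (v w : vec) : vec :=
  (radd v.1.1 w.1.1, radd v.1.2 w.1.2, radd v.2 w.2).

(* free rank-1 submodule of R_R^3: S = vR with {v} a basis (r |-> v r injective) *)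
Definition is_point (S : {set vec}) : Prop :=
  exists v : vec, injective (vscale v) /\ S = [set vscale v r | r : R].

(* free rank-2 submodule: S = uR + wR with {u, w} a basis *)
Definition is_line (S : {set vec}) : Prop :=
  exists u w : vec,
    injective (fun rs : R * R => vadd (vscale u rs.1) (vscale w rs.2)) /\
    S = [set vadd (vscale u rs.1) (vscale w rs.2) | rs : R * R].

Definition proj_arc (K : {set {set vec}}) (k n : nat) : Prop :=
  [/\ forall P, P \in K -> is_point P,
      #|K| = k &
      forall L : {set vec}, is_line L -> #|[set P in K | P \subset L]| <= n].
End Geometry.

Local Open Scope ring_scope.

(* F_4 = F_2[t]/(t^2+t+1), element (x,y) = x + y t *)
Definition F4 := ('F_2 * 'F_2)%type.
Definition F4add (a b : F4) : F4 := (a.1 + b.1, a.2 + b.2).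
Definition F4mul (a b : F4) : F4 :=
  (a.1 * b.1 + a.2 * b.2, a.1 * b.2 + a.2 * b.1 + a.2 * b.2).
(* Frobenius a |-> a^2 : (x + y t)^2 = (x + y) + y t *)
Definition F4frob (a : F4) : F4 := (a.1 + a.2, a.2).

(* G_4 = Z_4[X]/(X^2+X+1), element (a,b) = a + b w, w^2 = -w - 1 *)
Definition G4car := ('Z_4 * 'Z_4)%type.
Definition G4add (x y : G4car) : G4car := (x.1 + y.1, x.2 + y.2).
Definition G4mul (x y : G4car) : G4car :=
  (x.1 * y.1 - x.2 * y.2, x.1 * y.2 + x.2 * y.1 - x.2 * y.2).
Definition G4 : FinRingOps := @MkFinRingOps G4car G4add G4mul.

(* F_4[X; sigma]/(X^2), element (a,b) = a + b X, X c = sigma(c) X: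
   (a + bX)(c + dX) = ac + (ad + b sigma(c)) X *)
Definition F4Xadd (x y : F4 * F4) : F4 * F4 := (F4add x.1 y.1, F4add x.2 y.2).
Definition F4Xmul (sigma : F4 -> F4) (x y : F4 * F4) : F4 * F4 :=
  (F4mul x.1 y.1, F4add (F4mul x.1 y.2) (F4mul x.2 (sigma y.1))).

Definition S4 : FinRingOps :=
  @MkFinRingOps (F4 * F4)%type F4Xadd (F4Xmul id).
Definition T4 : FinRingOps :=
  @MkFinRingOps (F4 * F4)%type F4Xadd (F4Xmul F4frob).

(* Main.v *)
(** A line of PHG(2,R) is contained in the kernel of a linear form
    [h1 x1 + h2 x2 + h3 x3] with some coefficient equal to 1, because in each
    of the three rings every element is either a unit or annihilates one fixed
    [theta <> 0] from the left, so a basis of the line can be eliminated.  Hence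
    a set of points is a [(k,n)]-arc as soon as each of the 3 * 16^2 forms of
    this shape vanishes on at most [n] of its points.  The arcs are unions of
    orbits of [(x, y, z) |-> (x, -z, y + c z)] with [c^2 + c = 1], a collineation
    of order 5 fixing the point [(1, 0, 0)]; they were found by a tabu search over
    unions of orbits, and the bound is verified by computation on elements coded
    as numbers below 16. *)

From HB Require Import structures.
Require Import Defs.
From mathcomp Require Import all_boot all_algebra ring.
Set Implicit Arguments. Unset Strict Implicit. Unset Printing Implicit Defensive.
Import GRing.Theory.
Local Open Scope ring_scope.

(** * Ring structures on the three carriers *)

Definition ring_ops (A : finNzRingType) : FinRingOps :=
  @MkFinRingOps A +%R *%R.

(** A fresh name is needed because the pair type already carries the componentwise product as its
    ring multiplication. *)
Definition galois_ring := G4car.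
HB.instance Definition _ := Finite.copy galois_ring ('Z_4 * 'Z_4)%type.
HB.instance Definition _ := GRing.Zmodule.copy galois_ring ('Z_4 * 'Z_4)%type.

Definition galois_mul : galois_ring -> galois_ring -> galois_ring := G4mul.

Fact galois_mulA : associative galois_mul.
Proof. by move=> x y z; congr (_, _) => /=; ring. Qed.

Fact galois_mul1 : left_id ((1, 0) : galois_ring) galois_mul.
Proof. by move=> [x y]; congr (_, _) => /=; ring. Qed.

Fact galois_mulr1 : right_id ((1, 0) : galois_ring) galois_mul.
Proof. by move=> [x y]; congr (_, _) => /=; ring. Qed.

Fact galois_mulDl : left_distributive galois_mul +%R.
Proof. by move=> x y z; congr (_, _) => /=; ring. Qed.

Fact galois_mulDr : right_distributive galois_mul +%R.
Proof. by move=> x y z; congr (_, _) => /=; ring. Qed.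

Fact galois_1neq0 : (1, 0) != 0 :> galois_ring.
Proof. by []. Qed.

HB.instance Definition _ := GRing.Zmodule_isNzRing.Build galois_ring
  galois_mulA galois_mul1 galois_mulr1 galois_mulDl galois_mulDr galois_1neq0.

(** Holds by conversion, and lets ring lemmas speak about the points and lines of the given
    geometry. *)
Lemma G4E : G4 = ring_ops galois_ring.
Proof. by []. Qed.

Definition field4 := F4.
HB.instance Definition _ := Finite.copy field4 ('F_2 * 'F_2)%type.
HB.instance Definition _ := GRing.Zmodule.copy field4 ('F_2 * 'F_2)%type.

Definition field4_mul : field4 -> field4 -> field4 := F4mul.

Fact field4_mulA : associative field4_mul.
Proof. by move=> x y z; congr (_, _) => /=; ring. Qed.

Fact field4_mulC : commutative field4_mul.
Proof. by move=> x y; congr (_, _) => /=; ring. Qed.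

Fact field4_mul1 : left_id ((1, 0) : field4) field4_mul.
Proof. by move=> [x y]; congr (_, _) => /=; ring. Qed.

Fact field4_mulDl : left_distributive field4_mul +%R.
Proof. by move=> x y z; congr (_, _) => /=; ring. Qed.

Fact field4_1neq0 : (1, 0) != 0 :> field4.
Proof. by []. Qed.

HB.instance Definition _ := GRing.Zmodule_isComNzRing.Build field4
  field4_mulA field4_mulC field4_mul1 field4_mulDl field4_1neq0.

Definition frobenius : field4 -> field4 := F4frob.

Fact frobenius_zmod_morphism : zmod_morphism frobenius.
Proof. by move=> x y; congr (_, _) => /=; ring. Qed.

Fact frobenius_monoid_morphism : monoid_morphism frobenius.
Proof.
split=> [|x y]; congr (_, _) => /=; try ring.
(* Only the second coordinate is left; its two sides differ by [s + s], which vanishes in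
   characteristic 2. *)
pose s := x.2 * y.2.
have s2 : s + s = 0 by apply: (addrr_pchar2 (pchar_Fp _)).
transitivity (x.1 * y.2 + x.2 * y.1 + s + (s + s)); first by rewrite s2 addr0.
by rewrite /s; ring.
Qed.

HB.instance Definition _ :=
  GRing.isZmodMorphism.Build field4 field4 frobenius frobenius_zmod_morphism.
HB.instance Definition _ :=
  GRing.isMonoidMorphism.Build field4 field4 frobenius frobenius_monoid_morphism.

(** [sigma] indexes the type so that the identity (for [S4]) and the Frobenius (for [T4]) each carry
    their own multiplication on the same pairs. *)
Definition skew_dual (K : finNzRingType) (sigma : {rmorphism K -> K}) : Type :=
  (K * K)%type.

Section SkewDual.
Variables (K : finNzRingType) (sigma : {rmorphism K -> K}).
Local Notation S := (skew_dual sigma).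
HB.instance Definition _ := Finite.copy S (K * K)%type.
HB.instance Definition _ := GRing.Zmodule.copy S (K * K)%type.

Definition skew_mul (x y : S) : S := (x.1 * y.1, x.1 * y.2 + x.2 * sigma y.1).

Fact skew_mulA : associative skew_mul.
Proof.
move=> x y z; congr (_, _) => /=; rewrite ?mulrA //.
by rewrite rmorphM mulrDr mulrDl !mulrA addrA.
Qed.

Fact skew_mul1 : left_id ((1, 0) : S) skew_mul.
Proof. by move=> [x y]; congr (_, _); rewrite /= !mul1r ?mul0r ?addr0. Qed.

Fact skew_mulr1 : right_id ((1, 0) : S) skew_mul.
Proof. by move=> [x y]; congr (_, _); rewrite /= ?rmorph1 !mulr1 ?mulr0 ?add0r. Qed.

Fact skew_mulDl : left_distributive skew_mul +%R.
Proof. by move=> x y z; congr (_, _); rewrite /= !mulrDl // addrACA. Qed.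

Fact skew_mulDr : right_distributive skew_mul +%R.
Proof. by move=> x y z; congr (_, _); rewrite /= ?rmorphD !mulrDr // addrACA. Qed.

Fact skew_1neq0 : (1, 0) != 0 :> S.
Proof. by rewrite xpair_eqE oner_eq0. Qed.

HB.instance Definition _ := GRing.Zmodule_isNzRing.Build S
  skew_mulA skew_mul1 skew_mulr1 skew_mulDl skew_mulDr skew_1neq0.
End SkewDual.

Lemma S4E : S4 = ring_ops (skew_dual (idfun : {rmorphism field4 -> field4})).
Proof. by []. Qed.

Lemma T4E : T4 = ring_ops (skew_dual (frobenius : {rmorphism field4 -> field4})).
Proof. by []. Qed.

(** * Linear forms vanishing on a line *)

Definition dot (A : nzRingType) (h v : A * A * A) : A :=
  h.1.1 * v.1.1 + h.1.2 * v.1.2 + h.2 * v.2.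

Definition has_one (T : eqType) (o : T) (v : T * T * T) :=
  [|| v.1.1 == o, v.1.2 == o | v.2 == o].

(** Coefficients act on the left and scalars on the right, so associativity suffices and
    commutativity is never invoked. *)
Lemma dot_comb (A : finNzRingType) (h : A * A * A) (u w : vec (ring_ops A))
    (r s : A) :
  dot h (vadd (vscale u r) (vscale w s)) = dot h u * r + dot h w * s.
Proof.
rewrite /dot /vadd /vscale /= !mulrDr !mulrDl !mulrA.
by rewrite [X in X + _ = _]addrACA [LHS]addrACA.
Qed.

Section LineForm.
Variables (A : finNzRingType) (theta : A).
Let invertible (x : A) := exists2 y, x * y = 1 & y * x = 1.
Hypothesis theta_neq0 : theta != 0.
Hypothesis theta_inv : forall x, x * theta = 0 \/ invertible x.

(* The form is found by back substitution: [t] clears the first coordinate of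
   the second basis vector. *)
Lemma pivot_form (a1 a2 a3 b1 b2 b3 t : A) :
    a1 * t + b1 = 0 -> invertible a1 -> invertible (a2 * t + b2) ->
  exists h1 h2, h1 * a1 + h2 * a2 + a3 = 0 /\ h1 * b1 + h2 * b2 + b3 = 0.
Proof.
move=> ab1 [a' _ a'K] [b' _ b'K].
pose h2 := - (a3 * t + b3) * b'.
pose h1 := - (h2 * a2 + a3) * a'.
have h2E : h2 * (a2 * t + b2) + (a3 * t + b3) = 0.
  by rewrite -mulrA b'K mulr1 addNr.
have h1E : h1 * a1 + (h2 * a2 + a3) = 0 by rewrite -mulrA a'K mulr1 addNr.
exists h1, h2; split; first by rewrite -addrA.
(* This is the form applied to [t] times the first vector plus the second; its first coordinate
   vanishes by [ab1], and the rest is [h2E]. *)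
have : (h1 * a1 + (h2 * a2 + a3)) * t + (h1 * b1 + h2 * b2 + b3) = 0.
  rewrite -[RHS]h2E -[RHS]add0r -(mulr0 h1) -ab1 !mulrDl !mulrDr !mulrA.
  by rewrite [in RHS](addrACA (h2 * a2 * t)) [RHS]addrACA !addrA.
by rewrite h1E mul0r add0r.
Qed.

(** After elimination with the unit [a1], one of the two remaining entries is a unit and yields a
    form by [pivot_form]. Otherwise [theta] kills both, and the multipliers [t * theta] and [theta]
    give a nontrivial relation between the basis vectors. *)
Lemma pivot_forms (a1 a2 a3 b1 b2 b3 : A) :
    (forall r s, a1 * r + b1 * s = 0 -> a2 * r + b2 * s = 0 ->
       a3 * r + b3 * s = 0 -> s = 0) -> invertible a1 ->
  exists h1 h2 h3, [/\ (h2 == 1) || (h3 == 1),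
    h1 * a1 + h2 * a2 + h3 * a3 = 0 & h1 * b1 + h2 * b2 + h3 * b3 = 0].
Proof.
move=> inj a1V; have [a' a1K _] := a1V.
pose t := - (a' * b1).
have tE : a1 * t + b1 = 0 by rewrite mulrN mulrA a1K mul1r addNr.
have killed b a : (a * t + b) * theta = 0 -> a * (t * theta) + b * theta = 0.
  by rewrite mulrDl mulrA.
have [c2|c2V] := theta_inv (a2 * t + b2); last first.
  have [h1 [h2 [hu hw]]] := pivot_form a3 b3 tE a1V c2V.
  by exists h1, h2, 1; rewrite eqxx orbT !mul1r.
have [c3|c3V] := theta_inv (a3 * t + b3); last first.
  have [h1 [h3 [hu hw]]] := pivot_form a2 b2 tE a1V c3V.
  by exists h1, 1, h3; rewrite eqxx !mul1r -!(addrAC _ (h3 * _)).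
case/eqP: theta_neq0; apply: (inj (t * theta)); apply: killed => //.
by rewrite tE mul0r.
Qed.

(** Some coordinate of the first basis vector is a unit, and permuting coordinates reduces each case
    to [pivot_forms]. *)
Lemma line_form (L : {set vec (ring_ops A)}) : is_line L ->
  exists2 h : A * A * A, has_one 1 h & forall v, v \in L -> dot h v = 0.
Proof.
move=> [[[u1 u2] u3] [[[w1 w2] w3] [inj ->]]].
have inj0 r s : u1 * r + w1 * s = 0 -> u2 * r + w2 * s = 0 ->
    u3 * r + w3 * s = 0 -> (r, s) = (0, 0).
  move=> e1 e2 e3; apply: inj; rewrite /vadd /vscale /= e1 e2 e3.
  by rewrite !mulr0 !addr0.
suff [h h1 [hu hw]] : exists2 h : A * A * A, has_one 1 h &
    dot h (u1, u2, u3) = 0 /\ dot h (w1, w2, w3) = 0.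
  exists h => // v /imsetP[[r s] _ ->].
  by rewrite (dot_comb h (u1, u2, u3)) hu hw !mul0r addr0.
have swap (x y z : A) : x + y + z = y + x + z by rewrite (addrC x).
have [k1|] := theta_inv u1; last first.
  move=> uV; case: (@pivot_forms u1 u2 u3 w1 w2 w3 _ uV) => [r s e1 e2 e3|].
    by case: (inj0 r s e1 e2 e3).
  move=> h1 [h2 [h3 [h eu ew]]]; exists (h1, h2, h3) => //.
  by rewrite /has_one h orbT.
have [k2|] := theta_inv u2; last first.
  move=> uV; case: (@pivot_forms u2 u1 u3 w2 w1 w3 _ uV) => [r s e1 e2 e3|].
    by case: (inj0 r s e2 e1 e3).
  move=> h1 [h2 [h3 [h eu ew]]]; exists (h2, h1, h3).
    by case/orP: h => h; rewrite /has_one /= h ?orbT.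
  by rewrite /dot /= !(swap (h2 * _)).
have [k3|] := theta_inv u3; last first.
  move=> uV; case: (@pivot_forms u3 u1 u2 w3 w1 w2 _ uV) => [r s e1 e2 e3|].
    by case: (inj0 r s e2 e3 e1).
  move=> h1 [h2 [h3 [h eu ew]]]; exists (h2, h3, h1).
    by case/orP: h => h; rewrite /has_one /= h ?orbT.
  by rewrite /dot /= !(addrC _ (h1 * _)) !addrA.
(* Without a unit coordinate, [theta] annihilates the first basis vector, against injectivity. *)
have := inj0 theta 0; rewrite k1 k2 k3 !mulr0 !addr0.
by move=> /(_ erefl erefl erefl) [/eqP]; rewrite (negPf theta_neq0).
Qed.

End LineForm.

Local Open Scope nat_scope.

(** * Computable test on coded vectors *)

Definition code3 := (nat * nat * nat)%type.

(** With tabulated operations, the checks become lookups on numbers instead of arithmetic on ring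
    elements. *)
Definition tabulate (op : nat -> nat -> nat) : seq (seq nat) :=
  mkseq (fun i => mkseq (op i) 16) 16.

Definition look (t : seq (seq nat)) i j := nth 0 (nth [::] t i) j.

Section CodedOps.
Variables (add mul : seq (seq nat)) (z o : nat).

Definition code_scale (v : code3) r : code3 :=
  (look mul v.1.1 r, look mul v.1.2 r, look mul v.2 r).

Definition code_dot (h v : code3) :=
  look add (look add (look mul h.1.1 v.1.1) (look mul h.1.2 v.1.2))
           (look mul h.2 v.2).

(* If [w] is a multiple of a [v] having a coordinate 1, then this is the only
   possible multiplier, so distinctness of spans takes one test per pair. *)
Definition code_pivot (v w : code3) :=
  if v.1.1 == o then w.1.1 else if v.1.2 == o then w.1.2 else w.2.

Definition code_forms : seq code3 :=
  flatten [seq [:: (i, j, o); (i, o, j); (o, i, j)]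
          | i <- iota 0 16, j <- iota 0 16].

Definition arc_check (C : seq code3) k n :=
  [&& size C == k, uniq C,
      all (fun v => [&& v.1.1 < 16, v.1.2 < 16 & v.2 < 16]) C,
      all (has_one o) C,
      all (fun v => all (fun w =>
        (code_scale v (code_pivot v w) == w) ==> (v == w)) C) C &
      all (fun h => count (fun v => code_dot h v == z) C <= n) code_forms].

(** Rotation may lose the coordinate 1; a right multiple restores it. Since [find] runs over
    [iota 0 16], the index found is the code of the multiplier. *)
Definition normalize (v : code3) : code3 :=
  code_scale v (find (fun r => has_one o (code_scale v r)) (iota 0 16)).

(* Here [m] is the code of -1. *)
Definition rotate (m c : nat) (v : code3) : code3 :=
  (v.1.1, look mul m v.2, look add v.1.2 (look mul c v.2)).

(** The sizes are 166 = 1 + 5 * 33 and 186 = 1 + 5 * 37. No orbit property has to be proved, as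
    [arc_check] inspects the resulting list. *)
Definition orbit_arc (m c : nat) (reps : seq code3) : seq code3 :=
  (o, z, z) :: flatten
    [seq [seq normalize (iter i (rotate m c) v) | i <- iota 0 5] | v <- reps].

Definition theta_check (theta : nat) :=
  all (fun x => (look mul x theta == z) ||
    has (fun y => (look mul x y == o) && (look mul y x == o)) (iota 0 16))
  (iota 0 16).

End CodedOps.

(** * Soundness of the test *)

Section Coded.
Variables (A : finNzRingType) (enc : A -> nat) (dec : nat -> A).
Hypothesis encK : cancel enc dec.
Hypothesis decK : {in iota 0 16, cancel dec enc}.
Hypothesis enc_lt : forall x, enc x < 16.

Definition add_table := tabulate (fun i j => enc (dec i + dec j)%R).
Definition mul_table := tabulate (fun i j => enc (dec i * dec j)%R).
Local Notation add := add_table.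
Local Notation mul := mul_table.
Local Notation V := (vec (ring_ops A)).

Definition enc3 (v : V) : code3 := (enc v.1.1, enc v.1.2, enc v.2).
Definition dec3 (v : code3) : V := (dec v.1.1, dec v.1.2, dec v.2).

Lemma lookE (op : A -> A -> A) x y :
  look (tabulate (fun i j => enc (op (dec i) (dec j)))) (enc x) (enc y)
  = enc (op x y).
Proof. by rewrite /look !nth_mkseq ?encK. Qed.

Definition span (v : V) : {set V} := [set vscale v r | r : ring_ops A].

(** The coordinate 1 of [v] becomes [r] in the multiple of [v] by [r], so the multiplier can be read
    off. *)
Lemma span_point (v : V) : has_one 1%R v -> is_point (span v).
Proof.
move=> v1; exists v; split=> // r s [].
by case/or3P: v1 => /eqP ->; rewrite !mul1r.
Qed.

Lemma mem_span (v : V) : v \in span v.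
Proof.
by apply/imsetP; exists 1%R => //; case: v => [[x y] z]; rewrite /vscale /= !mulr1.
Qed.

Section Arc.
Variables (theta c : A).
Hypothesis theta_neq0 : theta != 0%R.
Hypothesis theta_ok : theta_check mul (enc 0%R) (enc 1%R) (enc theta).

Lemma theta_checkP x : (x * theta = 0 \/ exists2 y, x * y = 1 & y * x = 1)%R.
Proof.
have enc_inj := can_inj encK.
have /allP/(_ (enc x)) := theta_ok; rewrite mem_iota enc_lt => /(_ isT).
rewrite lookE => /orP[/eqP/enc_inj|/hasP[y y16 /andP[]]]; first by left.
rewrite -(decK y16) !lookE => /eqP/enc_inj xy /eqP/enc_inj yx.
by right; exists (dec y).
Qed.

(** The arc consists of the spans of the decoded vectors. The points of it on a line come from zeros
    of one form in [code_forms], which the check counts. *)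
Lemma arc_checkP (C : seq code3) k n :
  arc_check add mul (enc 0%R) (enc 1%R) C k n ->
  exists K : {set {set V}}, proj_arc K k n.
Proof.
case/and5P=> /eqP sizeC uniqC /allP ltC /allP oneC /andP[/allP pivC /allP cntC].
have enc_inj := can_inj encK.
have encC v : v \in C -> enc3 (dec3 v) == v.
  case: v => [[x y] z] /ltC /and3P[x16 y16 z16].
  by rewrite /enc3 /= !decK ?mem_iota.
have oneE v : has_one 1%R v = has_one (enc 1%R) (enc3 v).
  by rewrite /has_one /= !(inj_eq enc_inj).
have dotE h v : code_dot add mul (enc3 h) (enc3 v) = enc (dot h v).
  by rewrite /code_dot !lookE.
have scaleE v r : code_scale mul (enc3 v) (enc r) = enc3 (vscale v r).
  by rewrite /code_scale !lookE.
have oneD v : v \in C -> has_one 1%R (dec3 v).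
  by move=> Cv; rewrite oneE (eqP (encC v Cv)) oneC.
have span_inj : {in C &, injective (span \o dec3)}.
  move=> v w Cv Cw /= vw; apply/eqP.
  move/allP/(_ w Cw)/implyP: (pivC v Cv); apply.
  have: dec3 w \in span (dec3 v) by rewrite vw mem_span.
  case/imsetP=> r _ wE.
  have -> : code_pivot (enc 1%R) v w = enc r.
    rewrite -(eqP (encC v Cv)) -(eqP (encC w Cw)) wE /code_pivot /=.
    rewrite !(inj_eq enc_inj).
    have := oneD v Cv; rewrite /has_one /=.
    case: eqP => [->|_]; first by rewrite mul1r.
    case: eqP => [->|_ /= /eqP ->]; by rewrite mul1r.
  rewrite -[X in code_scale _ X _](eqP (encC v Cv)) scaleE -wE.
  exact: encC.
exists [set P in [seq span (dec3 v) | v <- C]]; split.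
- by move=> P; rewrite inE => /mapP[v Cv ->]; apply: span_point; apply: oneD.
- rewrite cardsE -sizeC -(size_map (span \o dec3)); apply/card_uniqP.
  by rewrite map_inj_in_uniq.
move=> L /(line_form theta_neq0 theta_checkP)[h h1 hL].
(* The position of the coefficient 1 selects the member of the block indexed by the other two
   coefficients. *)
have hC : enc3 h \in code_forms (enc 1%R).
  case: h h1 {hL} => [[x y] z] h1.
  have mem16 a : enc a \in iota 0 16 by rewrite mem_iota enc_lt.
  pose block i j := [:: (i, j, enc 1%R); (i, enc 1%R, j); (enc 1%R, i, j)].
  have in_forms a b f : f \in block (enc a) (enc b) -> f \in code_forms (enc 1%R).
    move=> fab; apply/flattenP; eexists; last exact: fab.
    exact: (allpairs_f block).
  case/or3P: h1 => /= /eqP ->.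
  - by apply: (in_forms y z); rewrite !inE eqxx !orbT.
  - by apply: (in_forms x z); rewrite !inE eqxx !orbT.
  - by apply: (in_forms x y); rewrite !inE eqxx.
apply: leq_trans (cntC _ hC); rewrite -size_filter -(size_map (span \o dec3)).
apply: leq_trans (card_size _); apply/subset_leq_card/subsetP=> P.
rewrite !inE => /andP[/mapP[v Cv ->] /subsetP/(_ _ (mem_span _)) /hL hv].
apply: map_f; rewrite mem_filter Cv andbT.
by rewrite -[X in code_dot _ _ _ X](eqP (encC v Cv)) dotE hv.
Qed.

Definition orbit_arc_check (reps : seq code3) k n :=
  arc_check add mul (enc 0%R) (enc 1%R)
    (orbit_arc add mul (enc 0%R) (enc 1%R) (enc (- 1)%R) (enc c) reps) k n.

Lemma orbit_arcs reps166 reps186 :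
    orbit_arc_check reps166 166 11 -> orbit_arc_check reps186 186 12 ->
  (exists K : {set {set V}}, proj_arc K 166 11) /\
  (exists K : {set {set V}}, proj_arc K 186 12).
Proof. by move=> ? ?; split; apply: arc_checkP; eassumption. Qed.

End Arc.
End Coded.

(** * Codings of the three rings and orbit representatives *)

Definition galois_enc (x : galois_ring) : nat := x.1 + 4 * x.2.
Definition galois_dec (n : nat) : galois_ring := (inZp n, inZp (n %/ 4)).

Lemma galois_encK : cancel galois_enc galois_dec.
Proof.
by case=> [[[|[|[|[|//]]]] ?] [[|[|[|[|//]]]] ?]]; congr (_, _); apply: val_inj.
Qed.

Lemma galois_decK : {in iota 0 16, cancel galois_dec galois_enc}.
Proof. by move=> i i16; apply/eqP; move: i i16; apply/allP. Qed.

Lemma galois_enc_lt x : galois_enc x < 16.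
Proof. by case: x => [[[|[|[|[|//]]]] ?] [[|[|[|[|//]]]] ?]]. Qed.

Section SkewCode.
Variable sigma : {rmorphism field4 -> field4}.

(** The coordinates over F_2 are the binary digits: 2 codes t and 4 codes X. In the decoder [inZp]
    reduces modulo 2. *)
Definition skew_enc (x : skew_dual sigma) : nat :=
  x.1.1 + 2 * x.1.2 + 4 * x.2.1 + 8 * x.2.2.
Definition skew_dec (n : nat) : skew_dual sigma :=
  ((inZp n, inZp (n %/ 2)), (inZp (n %/ 4), inZp (n %/ 8))).

Lemma skew_encK : cancel skew_enc skew_dec.
Proof.
by case=> [[[[|[|//]] ?] [[|[|//]] ?]] [[[|[|//]] ?] [[|[|//]] ?]]];
  congr ((_, _), (_, _)); apply: val_inj.
Qed.

Lemma skew_decK : {in iota 0 16, cancel skew_dec skew_enc}.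
Proof. by move=> i i16; apply/eqP; move: i i16; apply/allP. Qed.

Lemma skew_enc_lt x : skew_enc x < 16.
Proof. by case: x => [[[[|[|//]] ?] [[|[|//]] ?]] [[[|[|//]] ?] [[|[|//]] ?]]]. Qed.
End SkewCode.

(* The point [(1, 0, 0)], fixed by the collineation, is not listed in the orbit
   representatives below. *)
Definition galois_reps166 : seq code3 := [::
  (1, 0, 1); (1, 0, 3); (1, 0, 4); (1, 0, 5); (1, 0, 10); (1, 0, 12);
  (1, 0, 15); (1, 1, 2); (1, 1, 5); (1, 1, 6); (1, 1, 7); (1, 1, 8); (1, 1, 9);
  (1, 1, 11); (1, 1, 12); (1, 2, 6); (1, 2, 14); (1, 4, 5); (1, 4, 7);
  (1, 4, 8); (1, 4, 10); (1, 6, 11); (1, 7, 8); (1, 8, 7); (1, 10, 9);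
  (0, 1, 2); (0, 1, 6); (2, 1, 0); (2, 1, 1); (2, 1, 3); (2, 1, 4); (8, 1, 1);
  (8, 1, 3)].

Definition galois_reps186 : seq code3 := [::
  (1, 0, 1); (1, 0, 3); (1, 0, 6); (1, 0, 8); (1, 0, 14); (1, 1, 2); (1, 1, 3);
  (1, 1, 5); (1, 1, 6); (1, 1, 7); (1, 1, 9); (1, 1, 11); (1, 2, 6); (1, 2, 11);
  (1, 2, 13); (1, 2, 14); (1, 2, 15); (1, 3, 1); (1, 3, 11); (1, 3, 14);
  (1, 3, 15); (1, 4, 8); (1, 4, 10); (1, 5, 4); (1, 5, 13); (1, 6, 11);
  (1, 7, 8); (1, 8, 7); (1, 10, 9); (0, 1, 2); (0, 1, 3); (2, 1, 1); (2, 1, 2);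
  (2, 1, 4); (2, 1, 7); (8, 1, 1); (8, 1, 7)].

Definition dual_reps166 : seq code3 := [::
  (1, 0, 3); (1, 0, 9); (1, 0, 10); (1, 0, 11); (1, 0, 12); (1, 0, 13);
  (1, 0, 14); (1, 1, 4); (1, 1, 5); (1, 1, 6); (1, 1, 8); (1, 1, 9); (1, 1, 12);
  (1, 1, 15); (1, 2, 8); (1, 2, 10); (1, 2, 12); (1, 2, 13); (1, 2, 15);
  (1, 3, 4); (1, 3, 5); (1, 3, 6); (1, 3, 7); (1, 3, 8); (1, 3, 10); (0, 1, 0);
  (0, 1, 4); (4, 1, 0); (4, 1, 1); (4, 1, 12); (4, 1, 13); (8, 1, 9);
  (8, 1, 13)].

Definition dual_reps186 : seq code3 := [::
  (1, 0, 1); (1, 0, 2); (1, 0, 4); (1, 0, 5); (1, 0, 6); (1, 0, 10); (1, 0, 13);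
  (1, 0, 14); (1, 1, 4); (1, 1, 5); (1, 1, 6); (1, 1, 7); (1, 1, 9); (1, 1, 12);
  (1, 1, 13); (1, 1, 14); (1, 1, 15); (1, 2, 8); (1, 2, 10); (1, 2, 11);
  (1, 2, 12); (1, 2, 13); (1, 2, 14); (1, 3, 4); (1, 3, 7); (1, 3, 8);
  (1, 3, 9); (1, 3, 10); (1, 3, 11); (1, 3, 12); (1, 3, 13); (0, 1, 0);
  (0, 1, 5); (4, 1, 0); (4, 1, 1); (4, 1, 5); (4, 1, 12)].

Definition skew_reps166 : seq code3 := [::
  (1, 0, 1); (1, 0, 2); (1, 0, 3); (1, 0, 6); (1, 0, 7); (1, 0, 8); (1, 0, 10);
  (1, 0, 11); (1, 0, 13); (1, 1, 4); (1, 1, 6); (1, 1, 8); (1, 1, 11);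
  (1, 1, 13); (1, 1, 15); (1, 2, 4); (1, 2, 6); (1, 2, 7); (1, 2, 9);
  (1, 2, 10); (1, 2, 12); (1, 3, 5); (1, 3, 6); (1, 3, 8); (1, 3, 14);
  (0, 1, 8); (0, 1, 12); (4, 1, 8); (4, 1, 9); (4, 1, 12); (4, 1, 13);
  (8, 1, 0); (8, 1, 4)].

Definition skew_reps186 : seq code3 := [::
  (1, 0, 2); (1, 0, 3); (1, 0, 6); (1, 0, 8); (1, 0, 11); (1, 1, 4); (1, 1, 5);
  (1, 1, 6); (1, 1, 8); (1, 1, 10); (1, 1, 11); (1, 1, 12); (1, 1, 14);
  (1, 2, 5); (1, 2, 6); (1, 2, 7); (1, 2, 8); (1, 2, 9); (1, 2, 10); (1, 2, 13);
  (1, 2, 14); (1, 3, 4); (1, 3, 5); (1, 3, 6); (1, 3, 8); (1, 3, 10);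
  (1, 3, 11); (1, 3, 12); (1, 3, 14); (0, 1, 4); (0, 1, 8); (4, 1, 1);
  (4, 1, 4); (4, 1, 8); (4, 1, 13); (8, 1, 0); (8, 1, 12)].

(** * The arcs over the three rings *)

Lemma galois_arcs :
  (exists K : {set {set vec G4}}, proj_arc K 166 11) /\
  (exists K : {set {set vec G4}}, proj_arc K 186 12).
Proof.
(* Here theta = 2 and c = 2 + w, so that c^2 + c = w^2 + w + 2 = 1. *)
rewrite G4E; apply: (@orbit_arcs _ _ _ galois_encK galois_decK galois_enc_lt
  (2%:R, 0)%R (2%:R, 1)%R _ _ galois_reps166 galois_reps186); by vm_compute.
Qed.

Lemma dual_arcs :
  (exists K : {set {set vec S4}}, proj_arc K 166 11) /\
  (exists K : {set {set vec S4}}, proj_arc K 186 12).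
Proof.
(* Here theta = X and c = t, with t^2 + t = 1 in characteristic 2. *)
rewrite S4E; apply: (@orbit_arcs _ _ _ (@skew_encK idfun) (@skew_decK idfun)
  (@skew_enc_lt idfun)
  (0, (1, 0))%R ((0, 1), 0)%R _ _ dual_reps166 dual_reps186); by vm_compute.
Qed.

Lemma skew_arcs :
  (exists K : {set {set vec T4}}, proj_arc K 166 11) /\
  (exists K : {set {set vec T4}}, proj_arc K 186 12).
Proof.
(* The same theta and c serve: the collineation multiplies by c on the left, hence stays right
   linear despite the twist. *)
rewrite T4E; apply: (@orbit_arcs _ _ _ (@skew_encK frobenius) (@skew_decK frobenius)
  (@skew_enc_lt frobenius)
  (0, (1, 0))%R ((0, 1), 0)%R _ _ skew_reps166 skew_reps186); by vm_compute.
Qed.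

Theorem theorem3p7 (R : FinRingOps) :
  R = G4 \/ R = S4 \/ R = T4 ->
  (exists K : {set {set vec R}}, proj_arc K 166 11) /\
  (exists K : {set {set vec R}}, proj_arc K 186 12).
Proof.
by case=> [->|[->|->]]; [apply: galois_arcs | apply: dual_arcs | apply: skew_arcs].
Qed.
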